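(* Let $\mathbb{L}$ be a finite modular lattice. If $\mathbb{L}$ does not split strongly, then the number of admissible operation sequences on $\mathbb{L}$ is finite; if $\mathbb{L}$ splits strongly, then the number of admissible operation sequences on $\mathbb{L}$ is countably infinite.
   Context: $\mathbb{N}$ denotes the set of positive integers; $0$ and $1$ denote the least and greatest element of a lattice. Splitting. Let $\mathbb{L}$ be a complete lattice and $\delta,\varepsilon\in\mathbb{L}$. The pair $(\delta,\varepsilon)$ is a splitting pair of $\mathbb{L}$ if $\delta<1$, $\varepsilon>0$, and for all $\alpha\in\mathbb{L}$ we have $\alpha\ge\varepsilon$ or $\alpha\le\delta$. A splitting pair is strong if $\delta\ge\varepsilon$. The lattice $\mathbb{L}$ splits strongly if it has a strong splitting pair. Operation sequences. An operation sequence on $\mathbb{L}$ is a sequence $(f_i)_{i\in\mathbb{N}}$ with $f_i:\mathbb{L}^i\to\mathbb{L}$ for each $i\in\mathbb{N}$. It is admissible if for all $n,k\in\mathbb{N}$ with $k\le n$ and all elements $\alpha_1,\alpha_2,\ldots$ of $\mathbb{L}$: - (HC1) $f_n(\alpha_1,\ldots,\alpha_n)\le\alpha_k$; - (HC2) $f_n$ is monotonous, i.e. preserves $\le$; - (HC3) $f_{n+1}(\alpha_1,\ldots,\alpha_{n+1})\le f_n(\alpha_2,\ldots,\alpha_{n+1})$; - (HC4) $f_n$ is symmetric, i.e. $f_n(\alpha_1,\ldots,\alpha_n)=f_n(\alpha_{\pi(1)},\ldots,\alpha_{\pi(n)})$ for all $\pi\in S_n$; - (HC7) $f_n$ is join distributive,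 i.e. for all $i\in\{1,\ldots,n\}$ and all families $\langle\beta_j : j\in J\rangle$ in $\mathbb{L}$, $f_n(\alpha_1,\ldots,\alpha_{i-1},\bigvee_{j\in J}\beta_j,\alpha_{i+1},\ldots,\alpha_n)=\bigvee_{j\in J}f_n(\alpha_1,\ldots,\alpha_{i-1},\beta_j,\alpha_{i+1},\ldots,\alpha_n)$; - (HC8) $f_k(\alpha_1,\ldots,\alpha_{k-1},f_{n-k+1}(\alpha_k,\ldots,\alpha_n))\le f_n(\alpha_1,\ldots,\alpha_n)$. *)

(* Defs.v *)
From HB Require Import structures.
From mathcomp Require Import all_boot all_order all_fingroup.
From mathcomp Require Import boolp classical_sets cardinality.

Set Implicit Arguments.
Unset Strict Implicit.
Unset Printing Implicit Defensive.

Import Order.TTheory.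
Local Open Scope order_scope.

Definition modular_lattice (d : Order.disp_t) (L : latticeType d) : Prop :=
  forall x y z : L, x <= z -> x `|` (y `&` z) = (x `|` y) `&` z.

Definition splitting_pair (d : Order.disp_t) (L : tbLatticeType d)
    (delta eps : L) : Prop :=
  [/\ delta < \top, \bot < eps
    & forall alpha : L, eps <= alpha \/ alpha <= delta].

Definition strong_splitting_pair (d : Order.disp_t) (L : tbLatticeType d)
    (delta eps : L) : Prop :=
  splitting_pair delta eps /\ eps <= delta.

Definition splits_strongly (d : Order.disp_t) (L : tbLatticeType d) : Prop :=
  exists delta eps : L, strong_splitting_pair delta eps.

(* [f n] is the operation of arity n + 1, so that there is no operation of
   arity 0. *)
Definition op_seq (T : Type) : Type := forall n : nat, n.+1.-tuple T -> T.

(* The indexing type [J] is arbitrary; since [L] is finite, the join of the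
   family is the iterated join of its finitely many values. *)
Definition family_join (d : Order.disp_t) (L : finTBLatticeType d) (J : Type)
    (b : J -> L) : L :=
  \join_(x : L | x \in range b) x.

Definition subst_tuple (T : Type) (n : nat) (a : n.-tuple T) (i : 'I_n) (x : T)
    : n.-tuple T :=
  [tuple if j == i then x else tnth a j | j < n].

Section Admissible.

Variables (d : Order.disp_t) (L : finTBLatticeType d).
Implicit Type f : op_seq L.

Definition HC1 f : Prop :=
  forall n (a : n.+1.-tuple L) (k : 'I_n.+1), f n a <= tnth a k.

Definition HC2 f : Prop :=
  forall n (a b : n.+1.-tuple L),
    (forall i, tnth a i <= tnth b i) -> f n a <= f n b.

Definition HC3 f : Prop :=
  forall n (a : n.+2.-tuple L), f n.+1 a <= f n [tuple of behead a].

Definition HC4 f : Prop :=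
  forall n (a : n.+1.-tuple L) (s : 'S_n.+1),
    f n a = f n [tuple tnth a (s i) | i < n.+1].

Definition HC7 f : Prop :=
  forall n (a : n.+1.-tuple L) (i : 'I_n.+1) (J : Type) (b : J -> L),
    f n (subst_tuple a i (family_join b)) =
    family_join (fun j => f n (subst_tuple a i (b j))).

(* For 1 <= k <= n, the arguments of f_n are split as [a ++ b], where [a] has
   length p = k - 1 and [b] has length q + 1 = n - k + 1. *)
Definition HC8 f : Prop :=
  forall p q (a : p.-tuple L) (b : q.+1.-tuple L),
    f p [tuple of rcons a (f q b)]
      <= f (p + q)%N (tcast (addnS p q) [tuple of a ++ b]).

Definition admissible f : Prop :=
  [/\ HC1 f, HC2 f & HC3 f] /\ [/\ HC4 f, HC7 f & HC8 f].

End Admissible.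

(* Main.v *)
Require Import Defs.
From mathcomp Require Import all_boot all_order all_fingroup.
From mathcomp Require Import boolp classical_sets cardinality.
From mathcomp Require Import zify.

(** An admissible sequence is symmetric, so it amounts to one function [F] on
finite multisets of elements of [L]; by (HC3) a larger multiset has a
smaller value.  Below, [b K^n] is the multiset [b] with [n] extra copies of
every element of a set [K].  Call [F] stable at [N] when raising to any value
a multiplicity that is already at least [N] does not change [F].  A sequence
stable at [N] is determined by its values on the finitely many multisets with
multiplicities at most [N], so for a fixed [N] there are only finitely many
(lemma [finite_stable]).  Three facts then give the theorem.

Every admissible sequence is stable at some [N] ([stable_single]), whence
countability.  This replaces an appeal to Dickson's lemma: one shows, by
induction on the size of the complement of [K], that for some [n] the value
[F (b K^n)] is the limit of the values [F (b K^m)], simultaneously for all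
[b] ([stable_ind]).  If some [p] outside [K] is frequent in [b], the claim for
[p |: K] applies; otherwise [b] is small outside [K], and there are only
finitely many cases.

If [L] does not split strongly, one [N] works for all admissible sequences
([stable_uniform]), whence finiteness.  The key is [splits_of_drop]: suppose
that [F (b K^(n+2))] is not below [u], that [F (b p K^(n+1)) <= u] for every
[p] outside [K], and that [F (b K^m) <= u] for some [m].  Let [y] be the last
[F (b K^k)] that is not below [u] and [delta] the join of the complement of
[K].  By (HC1) [y] is below all elements of [K], and every element outside [K]
is below [delta]; by join distributivity [delta < 1]; and by (HC8) [y] cannot
be in [K], so [y <= delta].  Thus [(delta, y)] is a strong splitting pair.  So
without strong splitting, as long as [F (b K^n)] has not reached its limit one
can trade a copy of [K] for an element [p] outside [K], and after a bounded
number of trades such an element has become frequent.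

If [(delta, eps)] is a strong splitting pair, then for every [N] the operations
of arity at most [N] with value [eps] where no argument is below [delta] and
[0] elsewhere, followed by zero operations, form an admissible sequence: nested
values vanish because [eps <= delta].  They are pairwise distinct
([truncated_admissible], [truncated_inj]), so there are infinitely many. *)

Set Implicit Arguments.
Unset Strict Implicit.
Unset Printing Implicit Defensive.

Import Order.TTheory.
Local Open Scope order_scope.

(** * Operation sequences as functions of multisets *)

Lemma family_join_le (d : Order.disp_t) (L : finTBLatticeType d) (J : Type)
    (b : J -> L) (u : L) :
  family_join b <= u <-> forall j, b j <= u.
Proof.
split=> [/joinsP le_u j|le_u]; first by apply: le_u; rewrite inE; exists j.
by apply/joinsP => x; rewrite inE => -[j _ <-].
Qed.

(** [count_mem] with one fixed equality structure on [L], so that [lia] sees equal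
multiplicities as the same atom. *)
Definition mult (d : Order.disp_t) (L : finTBLatticeType d) (x : L) (s : seq L)
  : nat := count_mem x s.
Arguments mult : simpl never.

Section MultisetForm.

Variables (d : Order.disp_t) (L : finTBLatticeType d).
Implicit Types (f : op_seq L) (s t b : seq L).

(** Multisets are represented by lists.  The empty one gets the value [\top],
which keeps the function antitone and [seq_op_nested] valid for an empty inner
list. *)
Definition seq_op f s : L :=
  if s is x :: s' then f (size s') (in_tuple (x :: s')) else \top.

Lemma seq_opE f n (a : n.+1.-tuple L) : seq_op f a = f n a.
Proof.
case: a => -[|x s] //= sz_a; have [eq_n] := eqP sz_a.
by case: n / eq_n sz_a => sz_a; congr (f _ _); apply: val_inj.
Qed.

Lemma seq_op_inj f g : seq_op f =1 seq_op g -> f = g.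
Proof.
move=> eq_fg; apply: functional_extensionality_dep => n; apply/funext => a.
by rewrite -!seq_opE.
Qed.

Variable f : op_seq L.
Hypothesis adm : admissible f.
Local Notation F := (seq_op f).

Lemma seq_op_le_mem s x : x \in s -> F s <= x.
Proof.
case: adm => -[hc1 _ _] _; case: s => [|y s] // x_s.
have x_lt : (index x (y :: s) < (size s).+1)%N by rewrite index_mem.
have := hc1 _ (in_tuple (y :: s)) (Ordinal x_lt).
by rewrite (tnth_nth x) nth_index.
Qed.

Lemma seq_op_cons_mono s x y : x <= y -> F (x :: s) <= F (y :: s).
Proof.
case: adm => -[_ hc2 _] _ le_xy; apply: hc2 => i.
by rewrite !(tnth_nth x); case: i => -[|i] //= i_lt; apply: lexx.
Qed.

Lemma seq_op_perm s t : perm_eq s t -> F s = F t.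
Proof.
case: adm => _ [hc4 _ _]; case: t => [|y t] => [/perm_nilP->//|].
move=> /(@tuple_permP _ _ _ (in_tuple (y :: t)))[p ->].
by rewrite seq_opE -hc4.
Qed.

Lemma seq_op_cons_le s x : F (x :: s) <= F s.
Proof.
case: adm => -[_ _ hc3] _; case: s => [|y s]; first exact: lex1.
by apply: le_trans (hc3 _ (in_tuple [:: x, y & s])) _; rewrite -seq_opE.
Qed.

Lemma seq_op_anti s t : (forall x, (mult x s <= mult x t)%N) -> F t <= F s.
Proof.
move=> /count_subseqP[u /perm_to_subseq[v /seq_op_perm->] /seq_op_perm->].
rewrite (seq_op_perm (permEl (perm_catC u v))).
elim: v => [|x v IHv]; first exact: lexx.
exact: le_trans (seq_op_cons_le _ _) IHv.
Qed.

(** Join distributivity is only ever used for upper bounds of values, and for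
those the join over a predicate is more convenient than that of a family. *)
Lemma seq_op_join_le (P : pred L) s u :
  (forall x, P x -> F (x :: s) <= u) -> F ((\join_(x | P x) x) :: s) <= u.
Proof.
case: adm => _ [_ hc7 _] le_u.
pose a := in_tuple (\bot :: s).
have substE x : seq_op f (subst_tuple a ord0 x) = F (x :: s).
  congr seq_op; apply: (@eq_from_nth _ \bot) => [|i]; rewrite size_tuple // => i_lt.
  rewrite -(tnth_nth _ _ (Ordinal i_lt)) tnth_mktuple.
  by case: i i_lt => [|i] i_lt //; rewrite (tnth_nth \bot).
have -> : \join_(x | P x) x = family_join (fun x : {x | P x} => sval x).
  apply: le_anti; apply/andP; split.
    apply/joinsP => x Px; have /family_join_le := lexx (family_join (@sval L P)).
    by move/(_ (exist _ x Px)).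
  by apply/family_join_le => -[x Px]; exact: (joins_sup id).
rewrite -substE seq_opE hc7; apply/family_join_le => -[x Px].
by rewrite -seq_opE substE le_u.
Qed.

Lemma seq_op_nested s t : F (F t :: s) <= F (s ++ t).
Proof.
case: t => [|x t].
  by rewrite cats0; apply: seq_op_cons_le.
case: adm => _ [_ _ hc8].
have := hc8 _ _ (in_tuple s) (in_tuple (x :: t)).
rewrite -!seq_opE val_tcast; apply: le_trans.
by rewrite (@seq_op_perm _ (rcons s (F (x :: t)))) // perm_sym perm_rcons.
Qed.

End MultisetForm.

(** * Multiplicities and copies of a set *)

Section Copies.

Variables (d : Order.disp_t) (L : finTBLatticeType d).
Implicit Types (K : {set L}) (s t b : seq L).

Definition copies K n : seq L := flatten [seq nseq n x | x <- enum K].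

Definition off K s := [seq x <- s | x \notin K].

Lemma mult_cat x s t : mult x (s ++ t) = (mult x s + mult x t)%N.
Proof. exact: count_cat. Qed.

Lemma mult_cons x y s : mult x (y :: s) = ((x == y) + mult x s)%N.
Proof. by rewrite eq_sym. Qed.

Lemma mult_le_size x s : (mult x s <= size s)%N.
Proof. exact: count_size. Qed.

Lemma mult_copies K n x : mult x (copies K n) = (if x \in K then n else 0)%N.
Proof.
rewrite /copies -mem_enum; have := enum_uniq K.
elim: (enum K) => //= y s IHs /andP[yNs /IHs IHx].
rewrite mult_cat IHx in_cons [mult _ _]count_nseq /= eq_sym.
by case: eqP yNs => [<- /negPf->|_ _]; rewrite ?mul1n ?addn0.
Qed.

Lemma mult_off K s x : mult x (off K s) = (if x \in K then 0 else mult x s)%N.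
Proof.
elim: s => [|y s IHs] /=; first by rewrite if_same.
case: ifP => [|/negbFE] yK; rewrite ?mult_cons IHs; case: eqP => [->|_] //.
  by rewrite (negPf yK).
by rewrite yK.
Qed.

Definition multE := (mult_cat, mult_cons, mult_copies, mult_off).

Lemma mem_copies K n x : x \in K -> x \in copies K n.+1.
Proof.
by move=> xK; rewrite -has_pred1 has_count -[count _ _]/(mult x _) mult_copies xK.
Qed.

(** * Strong splitting pairs from late drops *)

(** A value that persists for a while and drops late, although it drops early
in every direction [p] outside [K], yields a strong splitting pair: the join of
the complement of [K] and the last value before the drop. *)
Lemma splits_of_drop (f : op_seq L) K b n m u :
    admissible f ->
    ~~ (seq_op f (b ++ copies K n.+2) <= u) ->
    (forall p, p \notin K -> seq_op f (p :: b ++ copies K n.+1) <= u) ->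
    seq_op f (b ++ copies K m) <= u ->
  splits_strongly L.
Proof.
move=> adm high low_off low_m.
have anti := seq_op_anti adm.
have [M low_M minM] :=
  ex_minnP (ex_intro (fun k => seq_op f (b ++ copies K k) <= u) m low_m).
have lt_nM : (n.+2 < M)%N.
  rewrite ltnNge; apply: contra high => le_Mn; apply: le_trans low_M.
  by apply: anti => x; rewrite !multE; case: (x \in K); lia.
case: M lt_nM low_M minM => // M lt_nM low_M minM.
pose y := seq_op f (b ++ copies K M).
have y_high : ~~ (y <= u) by apply/negP => /minM; rewrite ltnn.
have y_le p : p \in K -> y <= p.
  move=> pK; apply: seq_op_le_mem => //; rewrite mem_cat.
  by case: M lt_nM {low_M minM y y_high} => // M _; rewrite mem_copies ?orbT.
have y_off : y \notin K.
  apply: contra high => yK.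
  apply: le_trans (_ : seq_op f (y :: b ++ copies K n.+1) <= u).
    apply: anti => x; rewrite !multE.
    by case: eqP => [->|_]; [rewrite yK | case: ifP]; lia.
  (* Nesting merges the n + 1 copies around y with the M copies inside it,
     reaching at least M + 1. *)
  apply: le_trans (seq_op_nested adm _ _) _; apply: le_trans low_M.
  by apply: anti => x; rewrite !multE; case: (x \in K); lia.
have [p pK] : exists p, p \in K.
  apply/finset.set0Pn; apply: contraNneq high => K0; apply: le_trans low_m.
  by apply: anti => x; rewrite !multE K0 inE.
pose del := \join_(q | q \notin K) q.
exists del, y; split; last by exact: (joins_sup id).
split=> [||q].
- rewrite lt_neqAle lex1 andbT; apply: contraNneq high => del1.
  have := seq_op_join_le adm low_off; rewrite -/del del1; apply: le_trans.
  apply: le_trans (_ : _ <= seq_op f (p :: b ++ copies K n.+1)) _.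
    apply: anti => x; rewrite !multE.
    by case: eqP => [->|_]; [rewrite pK | case: ifP]; lia.
  exact: seq_op_cons_mono (lex1 _).
- rewrite lt_neqAle le0x andbT; apply: contraNneq y_high => <-; exact: le0x.
- by have [/y_le|qK] := boolP (q \in K); [left | right; exact: (joins_sup id)].
Qed.

(** * Stability *)

Definition persists (f : op_seq L) K n : Prop :=
  forall b m, seq_op f (b ++ copies K n) <= seq_op f (b ++ copies K m).

(** A list rich in the elements of [K] contains its [off K] part together with
[copies K n], to which persistence applies; adding [size t] copies covers the
elements of [K] that were discarded from [t]. *)
Lemma persists_saturated f K n t m :
    admissible f -> persists f K n ->
    (forall x, x \in K -> (n <= mult x t)%N) ->
  seq_op f t <= seq_op f (t ++ copies K m).
Proof.
move=> adm pers sat.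
apply: le_trans (_ : _ <= seq_op f (off K t ++ copies K n)) _.
  apply: seq_op_anti => // x; rewrite !multE.
  by have [/sat|_] := boolP (x \in K) => /=; lia.
apply: le_trans (pers _ (size t + m)%N) _.
apply: seq_op_anti => // x; rewrite !multE.
by have := mult_le_size x t; case: (x \in K) => /=; lia.
Qed.

(** The step from larger sets to [K]: persistence for [p |: K] decides the case
of the multisets [b] in which [p] is frequent. *)
Lemma persists_insert f K p n' b n m :
    admissible f -> persists f (p |: K) n' ->
    (n' <= mult p b)%N -> (n' <= n)%N ->
  seq_op f (b ++ copies K n) <= seq_op f (b ++ copies K m).
Proof.
move=> adm pers sat_p le_n.
apply: le_trans (persists_saturated m adm pers _) _ => [x|].
  rewrite in_setU1 !multE => /predU1P[->|->]; last lia.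
  by case: ifP; lia.
apply: seq_op_anti => // x; rewrite !multE in_setU1.
by case: (x == p); case: (x \in K) => /=; lia.
Qed.

Definition stable f N : Prop :=
  forall x t, (N <= mult x t)%N -> seq_op f t <= seq_op f (x :: t).

(** The induction on the size of the complement of [K], carried out for a whole
class [P] of sequences at once so that the bound is uniform in the class.  It
stops at the singletons [K], where persistence gives stability. *)
Lemma stable_ind (P : op_seq L -> Prop) :
    (forall f, P f -> admissible f) ->
    (forall n', exists n, forall f K, P f ->
       (forall p, p \notin K -> persists f (p |: K) n') -> persists f K n) ->
  exists N, forall f, P f -> stable f N.
Proof.
move=> Padm step.
have [N persN] : exists N, forall f, P f -> forall x, persists f [set x] N.
  suff pers k : exists n, forall f K, P f -> #|~: K| = k -> persists f K n.
    have [N persN] := pers #|L|.-1; exists N => f Pf x.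
    by apply: persN => //; rewrite cardsC1.
  elim: k => [|k [n' IHk]].
    have [n persn] := step 0%N; exists n => f K Pf /cards0_eq K0.
    apply: persn => // p pK; have : p \in ~: K by rewrite inE.
    by rewrite K0 inE.
  have [n persn] := step n'; exists n => f K Pf cardK; apply: persn => // p pK.
  apply: IHk => //; apply/eqP; rewrite -eqSS -cardK (cardsD1 p (~: K)) inE pK.
  by rewrite finset.setCU finset.setIC -finset.setDE.
exists N => f Pf x t sat.
apply: le_trans (persists_saturated 1 (Padm f Pf) (persN f Pf x) _) _ => [y|].
  by rewrite inE => /eqP->.
apply: seq_op_anti; first exact: Padm.
by move=> y; rewrite !multE inE; case: (y == x); lia.
Qed.

(** Each trade of a copy of [K] for an element outside [K] that is not yet
frequent in [b] reduces [room b], which is at most [#|L| * n']. *)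
Lemma stable_uniform :
  ~ splits_strongly L -> exists N, forall f, admissible f -> stable f N.
Proof.
move=> nsplit; apply: stable_ind => // n'.
exists (n' + (#|L| * n').+2)%N => f K adm pers.
pose room b := (\sum_(p | p \notin K) (n' - mult p b))%N.
suff walk r b m : (room b <= r)%N ->
    seq_op f (b ++ copies K (n' + r.+2)) <= seq_op f (b ++ copies K m).
  move=> b m; apply: walk.
  apply: leq_trans (_ : \sum_(p | p \notin K) n' <= _)%N.
    by apply: leq_sum => p _; apply: leq_subr.
  by rewrite sum_nat_const leq_mul2r max_card orbT.
elim/ltn_ind: r b => r IHr b room_b.
have [[p [pK sat_p]]|unsat] := pselect (exists p, p \notin K /\ (n' <= mult p b)%N).
  by apply: persists_insert (pers p pK) sat_p _; rewrite ?leq_addr.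
apply/negPn/negP => high; apply: nsplit.
have [[p [pK high_p]]|low] := pselect (exists p,
    p \notin K /\ ~~ (seq_op f (p :: b ++ copies K (n' + r).+1)
                      <= seq_op f (b ++ copies K m))); last first.
  (* No trade keeps the value above the target, so the drop to
     F (b K^m) is late in the sense of splits_of_drop. *)
  rewrite !addnS in high; apply: splits_of_drop adm high _ (lexx _) => p pK.
  by apply/negPn/negP => high_p; apply: low; exists p.
have room_p : (room (p :: b) < room b)%N.
  have lt_p : (mult p b < n')%N.
    by rewrite ltnNge; apply/negP => ?; apply: unsat; exists p.
  rewrite /room !(bigD1 p pK) /= mult_cons eqxx -addSn leq_add //; first lia.
  by apply: leq_sum => q _; rewrite mult_cons leq_sub2l ?leq_addl.
have r_gt0 : (0 < r)%N by lia.
case/negP: high_p; have := IHr r.-1 _ (p :: b); rewrite prednK // addnS => IHp.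
apply: le_trans (IHp _ _) _; [by [] | by lia | ].
exact: seq_op_cons_le.
Qed.

Lemma size_le_mult N s :
  (forall x, (mult x s <= N)%N) -> (size s <= N * #|L|)%N.
Proof.
move=> le_N; apply: leq_trans (_ : \sum_(x : L) mult x s <= _)%N; last first.
  by rewrite mulnC -sum_nat_const; apply: leq_sum => x _.
elim: s {le_N} => //= y s IHs; under eq_bigr do rewrite mult_cons.
rewrite big_split /= -[(size s).+1]add1n leq_add //.
by rewrite (bigD1 y) //= eqxx.
Qed.

(** For a single sequence the remaining multisets [b], in which every element
outside [K] is rare, are finitely many after removal of [K]; for each of them
and each value [v] pick an index at which [F (b K^j)] has fallen to [v], if [v]
is attained, and take the maximum. *)
Lemma stable_single f : admissible f -> exists N, stable f N.
Proof.
move=> adm; suff [N stN] : exists N, forall g, f = g -> stable g N.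
  by exists N; apply: stN.
apply: stable_ind => [g <- //|n'].
have /choice[j jP] (i : {set L} * (n' * #|L|).-bseq L * L) : exists k, forall m,
    seq_op f (i.1.2 ++ copies i.1.1 m) = i.2 ->
    seq_op f (i.1.2 ++ copies i.1.1 k) <= i.2.
  case: (pselect (exists m, seq_op f (i.1.2 ++ copies i.1.1 m) = i.2)).
    by move=> [k kP]; exists k => _ _; rewrite kP.
  by move=> noval; exists 0%N => m mP; case: noval; exists m.
exists (n' + \max_i j i)%N => _ K <- pers b m.
have [[p [pK sat_p]]|unsat] := pselect (exists p, p \notin K /\ (n' <= mult p b)%N).
  by apply: persists_insert (pers p pK) sat_p _; rewrite ?leq_addr.
have size_b : (size (off K b) <= n' * #|L|)%N.
  apply: size_le_mult => x; rewrite mult_off; case: ifPn => // xK.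
  by rewrite leqNgt; apply/negP => /ltnW ?; apply: unsat; exists x.
pose i := (K, Bseq size_b, seq_op f (off K b ++ copies K (size b + m))).
apply: le_trans (_ : _ <= seq_op f (off K b ++ copies K (j i))) _.
  have := @leq_bigmax _ j i; move: (\max_i _) (j i) => M k le_kM.
  by apply: seq_op_anti => // x; rewrite !multE; case: ifP => _; lia.
apply: le_trans (jP i _ erefl) _; apply: seq_op_anti => // x.
by rewrite !multE; have := mult_le_size x b; case: ifP => _; lia.
Qed.

(** Elements of multiplicity above [N] can be removed one at a time, so the
values on lists of length at most [N * #|L|] determine the sequence. *)
Lemma finite_stable N :
  finite_set [set f : op_seq L | admissible f /\ stable f N]%classic.
Proof.
pose small f := [ffun b : (N * #|L|).-bseq L => seq_op f b].
have small_inj : {in [set f : op_seq L | admissible f /\ stable f N]%classic &,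
    injective small}.
  move=> f g; rewrite !inE => -[admf stf] [admg stg] /ffunP eq_small.
  apply: seq_op_inj => s; have [k] := ubnP (size s); elim: k s => // k IHk s lt_sk.
  have [[x lt_x]|le_N] := pselect (exists x, (N < mult x s)%N); last first.
    have size_s : (size s <= N * #|L|)%N.
      apply: size_le_mult => x; rewrite leqNgt; apply/negP => ?.
      by apply: le_N; exists x.
    by have := eq_small (Bseq size_s); rewrite !ffunE.
  have xs : x \in s by rewrite -has_pred1 has_count (leq_trans _ lt_x).
  have rem_s := perm_to_rem xs.
  have le_rem : (N <= mult x (rem x s))%N.
    have : mult x s = mult x (x :: rem x s) by exact: (seq.permP rem_s).
    by rewrite mult_cons eqxx; lia.
  have drop h : admissible h -> stable h N -> seq_op h s = seq_op h (rem x s).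
    move=> admh sth; rewrite (seq_op_perm admh rem_s); apply: le_anti.
    by rewrite seq_op_cons_le // sth.
  rewrite (drop f) // (drop g) // IHk //.
  by have := perm_size rem_s => /=; lia.
rewrite -(eq_finite_set (inj_card_eq small_inj)); exact: finite_finset.
Qed.

End Copies.

(** * Infinitely many sequences on a strongly splitting lattice *)

Section Truncated.

Variables (d : Order.disp_t) (L : finTBLatticeType d) (delta eps : L).

Definition truncated (N : nat) : op_seq L := fun n a =>
  if (n < N)%N && all (fun x => ~~ (x <= delta)) a then eps else \bot.

Hypothesis split_de : strong_splitting_pair delta eps.

Lemma truncated_admissible N : admissible (truncated N).
Proof.
case: split_de => -[delta1 eps0 split_L] le_eps.
split; split; rewrite /truncated.
- move=> n a k; case: ifP => [/andP[_ /allP/(_ _ (mem_tnth k a))]|_];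
    last exact: le0x.
  by case: (split_L (tnth a k)) => // ->.
- move=> n a b le_ab; case: ifP => [/andP[-> /allP a_high]|_]; last exact: le0x.
  case: ifPn => //= /negP[]; apply/allP => _ /tnthP[i ->].
  by apply: contra (a_high _ (mem_tnth i a)); apply: le_trans.
- move=> n a; case: ifP => [/andP[lt_n]|_]; last exact: le0x.
  by case/tupleP: a => x a /= /andP[_]; rewrite ltnW //= => ->.
- move=> n a s; congr (if _ && _ then _ else _).
  apply: eq_all_r => x; apply/tnthP/tnthP => -[i ->]; last first.
    by exists (s i); rewrite tnth_mktuple.
  by exists (s^-1%g i); rewrite tnth_mktuple permKV.
(* (HC7): with the other arguments fixed, the operation is constantly 0 or maps
   x to eps exactly when x is not below delta; a join is below delta if and
   only if all its members are. *)
- move=> n a i J b.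
  pose rest := (n < N)%N && [forall (j | j != i), ~~ (tnth a j <= delta)].
  have substE x : (n < N)%N && all (fun x => ~~ (x <= delta)) (subst_tuple a i x)
      = rest && ~~ (x <= delta).
    rewrite -andbA; congr (_ && _).
    apply/allP/andP => [high|[/forall_inP high x_high]].
      split; last by have := high _ (mem_tnth i _); rewrite tnth_mktuple eqxx.
      apply/forall_inP => j ji.
      by have := high _ (mem_tnth j _); rewrite tnth_mktuple (negPf ji).
    move=> _ /tnthP[j ->]; rewrite tnth_mktuple.
    by case: eqP => // /eqP; apply: high.
  rewrite substE; under [in RHS]eq_fun do rewrite substE.
  apply: le_anti; apply/andP; split; last first.
    apply/family_join_le => j; case: ifP => [/andP[-> bj]|_]; last exact: le0x.
    rewrite /= ifT //; apply: contra bj.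
    by move/family_join_le; apply.
  case: ifP => [/andP[rest_a]|_]; last exact: le0x.
  move=> /negP/family_join_le/existsNP[j /negP bj].
  set g := fun _ => _; have /family_join_le/(_ j) := lexx (family_join g).
  by rewrite /g rest_a bj.
(* (HC8): the inner value is 0 or eps, hence below delta, so the outer one
   is 0. *)
- move=> p q a b.
  case: ifP => [/andP[_]|_]; last exact: le0x.
  rewrite all_rcons => /andP[/negP[]]; by case: ifP => // _; apply: le0x.
Qed.

Lemma truncated_inj : injective truncated.
Proof.
case: split_de => -[delta1 eps0 _] _.
have val N n : (truncated N (nseq_tuple n.+1 \top) == \bot) = (N <= n)%N.
  rewrite /truncated all_nseq /= lt_geF // andbT ltnNge.
  by case: (N <= n)%N; rewrite ?eqxx // gt_eqF.
by move=> M N eqMN; apply/eqP; rewrite eqn_leq -!val eqMN val leqnn -eqMN val leqnn.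
Qed.

End Truncated.

(** * The number of admissible sequences *)

Theorem theorem2p1 (d : Order.disp_t) (L : finTBLatticeType d)
    (L_modular : modular_lattice L) :
  (~ splits_strongly L ->
     finite_set [set f : op_seq L | admissible f]%classic) /\
  (splits_strongly L ->
     ([set f : op_seq L | admissible f] #= [set: nat])%card%classic).
Proof.
split=> [nsplit|[delta [eps split_de]]].
  have [N stN] := stable_uniform nsplit.
  apply: sub_finite_set (finite_stable L N) => f admf.
  by split=> //; apply: stN.
apply: eq_card_nat.
  apply: (@sub_countable _ _ _
    (\bigcup_N [set f : op_seq L | admissible f /\ stable f N])%classic).
    apply: subset_card_le => f admf.
    by have [N stN] := stable_single admf; exists N.
  apply: bigcup_countable => // N _; apply: finite_set_countable.
  exact: finite_stable.
have trunc_inj := truncated_inj split_de.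
apply/infiniteP; rewrite -(card_le_eql (inj_card_eq (in2W trunc_inj))).
by apply: subset_card_le => _ [N _ <-]; apply: truncated_admissible.
Qed.
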